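(* Let $p$ be a prime and let $G$ be a group that fits in a short exact sequence \[ 1 \to H \to G \to C_p \to 1, \] where $H$ is a finite, nontrivial, abelian $p$-group and $C_p$ denotes the cyclic group of order $p$. Then there exists a virtual endomorphism $\phi: H \to_p G$ with trivial core if and only if the sequence splits and $H$ is an elementary abelian $p$-group.
   Context: The group $H$ is identified with its image in $G$, a normal subgroup of index $p$. A virtual endomorphism (or $\frac1k$-endomorphism) $\phi: H\to_k G$ is a group homomorphism $\phi:H\to G$ defined on a subgroup $H$ of finite index $k$ in $G$. A subgroup $N\le H$ is $\phi$-invariant if $\phi(N)\subseteq N$. The core of $\phi$ is the largest subgroup of $H$ that is normal in $G$ and $\phi$-invariant; so $\phi$ has trivial core if and only if the only $\phi$-invariant subgroup contained in $H$ that is normal in $G$ is the trivial group. *)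

(* Defs.v *)
From mathcomp Require Import all_boot all_fingroup all_solvable.

Set Implicit Arguments.
Unset Strict Implicit.
Unset Printing Implicit Defensive.

Local Open Scope group_scope.

(* The groups involved are subgroups of ambient finite group types. An
   extension of a finite group by C_p is finite, so nothing is lost by taking
   the middle term finite. Library morphisms {morphism D >-> rT} are only
   meaningful on their domain D, and 'ker q is a subset of that domain. *)

(* 1 -> H -i-> G -q-> C -> 1 *)
Definition short_exact (hT gT cT : finGroupType)
    (H : {group hT}) (G : {group gT}) (C : {group cT})
    (i : {morphism H >-> gT}) (q : {morphism G >-> cT}) : Prop :=
  [/\ 'injm i, i @* H = 'ker q & q @* G = C].

Definition sequence_splits (gT cT : finGroupType)
    (G : {group gT}) (C : {group cT}) (q : {morphism G >-> cT}) : Prop :=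
  exists s : {morphism C >-> gT},
    s @* C \subset G /\ {in C, forall x, q (s x) = x}.

Definition virtual_endomorphism (gT : finGroupType) (k : nat)
    (G D : {group gT}) (phi : {morphism D >-> gT}) : Prop :=
  [/\ D \subset G, #|G : D| = k & phi @* D \subset G].

Definition phi_invariant (gT : finGroupType) (D : {group gT})
    (phi : {morphism D >-> gT}) (N : {group gT}) : bool :=
  (N \subset D) && (phi @* N \subset N).

(* The subgroup generated by all phi-invariant subgroups of D that are normal
   in G; vcoreP shows that it is the largest of them. *)
Definition vcore (gT : finGroupType) (G D : {group gT})
    (phi : {morphism D >-> gT}) : {group gT} :=
  (\prod_(N : {group gT} | phi_invariant phi N && (N <| G)) N)%G.

Lemma vcoreP (gT : finGroupType) (G D : {group gT})
    (phi : {morphism D >-> gT}) :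
  [/\ phi_invariant phi (vcore G phi), vcore G phi <| G &
      forall N : {group gT}, phi_invariant phi N -> N <| G ->
        N \subset vcore G phi].
Proof.
have [Hinv Hnor] : phi_invariant phi (vcore G phi) /\ vcore G phi <| G.
  rewrite /vcore; elim/big_ind: _ => [||N /andP[-> ->] //].
    by rewrite /phi_invariant sub1G morphim1 subxx normal1.
  move=> M N [/andP[sMD fM] nM] [/andP[sND fN] nN].
  rewrite /phi_invariant /= join_subG sMD sND morphimY // normalY //.
  by split=> //; apply: genS; apply: setUSS.
by split=> // N iN nN; rewrite /vcore (bigD1 N) ?iN //= joing_subl.
Qed.

Definition trivial_core (gT : finGroupType) (G D : {group gT})
    (phi : {morphism D >-> gT}) : Prop :=
  vcore G phi :=: 1.

(* Main.v *)
Require Import Defs.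
From mathcomp Require Import all_boot all_fingroup all_solvable.

Set Implicit Arguments.
Unset Strict Implicit.
Unset Printing Implicit Defensive.

Local Open Scope group_scope.

(** Identify H with its image K, a normal abelian subgroup of index p in the
p-group G. The sequence splits exactly when some t in G outside K has order p
([sequence_splits_prime]).

Suppose phi : K -> G has trivial core, and let A be its image. If A lay in K,
then K itself would be invariant; so G = K A, and as K and A are both abelian,
K :&: A is central in G. Two normal subgroups of G, which triviality of the
core prevents from being invariant unless they are trivial, give the conclusion.
- Let S consist of the solutions of x ^ p = 1 in K :&: Z(G); it is nontrivial
  since G is a p-group. Were phi(S) inside K, it would be inside
  K :&: A, hence central and of exponent p, hence inside S. So phi(S) contains
  an element t of order p outside K ([trivial_core_order_p]).
- Let K^p be the group of p-th powers of elements of K. An element of A can be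
  written k t^j with k in K, and k commutes with t because both lie in A; its
  p-th power is therefore k^p. Thus phi(K^p) = A^p is contained in K^p, so
  K^p = 1 and K is elementary abelian ([trivial_core_abelem]).

Conversely, let K be elementary abelian and t of order p outside K. Every
nontrivial normal subgroup of G meets U = K :&: Z(G) nontrivially, so only U
needs attention. Choose a basis u_1, ..., u_r of U, let phi act on U as the
shift u_1 -> u_2 -> ... -> u_r -> t, and let phi be trivial on a complement of
U in K. Iterating the shift on a nontrivial element of U eventually produces
an element with a nontrivial t-component, which is outside K
([abelem_shift], [exists_trivial_core]). *)

Lemma trivial_coreP (gT : finGroupType) (G D : {group gT})
    (phi : {morphism D >-> gT}) :
  trivial_core G phi <->
  forall N : {group gT}, phi_invariant phi N -> N <| G -> N :=: 1.
Proof.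
have [Cinv Cnor Cmax] := vcoreP G phi.
split=> [core1 N Ninv Nnor | all1]; last exact: all1.
by apply/trivgP; rewrite -core1 Cmax.
Qed.

Section PrimeIndex.

Variables (p : nat) (gT : finGroupType) (G K : {group gT}).
Hypotheses (pr_p : prime p) (nKG : K <| G) (iKG : #|G : K| = p).

(** A subgroup of prime index is maximal. *)
Lemma mul_prime_index (A : {group gT}) :
  A \subset G -> ~~ (A \subset K) -> K * A = G.
Proof.
move=> sAG not_sAK; apply: mulg_normal_maximal => //.
by apply: p_index_maximal; rewrite ?normal_sub // iKG.
Qed.

Section Necessity.

Variable phi : {morphism K >-> gT}.
Hypotheses (sphiG : phi @* K \subset G) (core1 : trivial_core G phi).
Hypotheses (ntK : K :!=: 1) (abK : abelian K) (pK : p.-group K).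

Lemma prime_index_pgroup : p.-group G.
Proof.
rewrite -(pquotient_pgroup pK (normal_norm nKG)) /pgroup.
by rewrite card_quotient ?normal_norm // iKG pnat_id.
Qed.

(** Otherwise K itself would be a nontrivial invariant normal subgroup. *)
Lemma image_not_sub : ~~ (phi @* K \subset K).
Proof.
apply: contra ntK => sphiK; apply/eqP.
by apply: (proj1 (trivial_coreP G phi) core1); rewrite // /phi_invariant subxx.
Qed.

(** G is the product of the two abelian groups K and phi(K), and both of them
centralise their intersection. *)
Lemma cap_image_central : K :&: phi @* K \subset 'Z(G).
Proof.
have abA : abelian (phi @* K) by rewrite morphim_abelian.
rewrite /center subsetI subIset ?(normal_sub nKG) //=.
rewrite -(mul_prime_index sphiG image_not_sub) centM subsetI.
by rewrite (subset_trans (subsetIl _ _) abK) (subset_trans (subsetIr _ _) abA).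
Qed.

(** The p-torsion S of K :&: Z(G) is nontrivial and normal in G. Were phi(S)
contained in K, it would be a group of exponent p inside K :&: Z(G), so inside
S, and S would be invariant. *)
Lemma trivial_core_order_p : exists2 t, t \in phi @* K :\: K & #[t] = p.
Proof.
pose Z := (K :&: 'Z(G))%G; pose S := 'Ohm_1(Z)%G.
have nZG : Z <| G by rewrite normalI ?center_normal.
have sZK : Z \subset K by rewrite subsetIl.
have sSK : S \subset K by rewrite (subset_trans (Ohm_sub _ _)).
have nSG : S <| G by rewrite (char_normal_trans (Ohm_char _ _)).
have ntS : S :!=: 1.
  by rewrite Ohm1_eq1 meet_center_nil ?(pgroup_nil prime_index_pgroup).
have eS : p.-abelem S.
  by rewrite Ohm1_abelem ?(pgroupS sZK) ?(abelianS sZK).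
have eT : p.-abelem (phi @* S) by rewrite morphim_abelem.
have: ~~ (phi @* S \subset K).
  apply: contra ntS => sTK; apply/eqP.
  apply: (proj1 (trivial_coreP G phi) core1) => //.
  (* phi(S) has exponent p, so it lies in S once it lies in K :&: Z(G). *)
  rewrite /phi_invariant sSK -(Ohm1_id eT) OhmS //= subsetI sTK.
  by rewrite (subset_trans _ cap_image_central) // subsetI sTK morphimS.
case/subsetPn=> t tT not_tK; exists t.
  by rewrite inE not_tK (subsetP (morphimS phi sSK)).
rewrite (abelem_order_p eT) //.
by apply: contraNneq not_tK => ->.
Qed.

(** Let t be an element of order p of phi(K) outside K. Then phi(K) is
generated by t and its intersection with K, and t contributes nothing to p-th
powers: the p-th powers of phi(K) are p-th powers of K. So the subgroup of p-th powers of K is invariant, hence trivial. *)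
Lemma trivial_core_abelem : p.-abelem K.
Proof.
have [t /setDP[tA not_tK] ot] := trivial_core_order_p.
have abA : abelian (phi @* K) by rewrite morphim_abelian.
have tp1 : t ^+ p = 1 by rewrite -ot expg_order.
have KtG : K * <[t]> = G.
  by apply: mul_prime_index; rewrite cycle_subG // (subsetP sphiG).
have Mho1 : 'Mho^1(K) :=: 1.
  apply: (proj1 (trivial_coreP G phi) core1); last first.
    by rewrite (char_normal_trans (Mho_char _ _)).
  rewrite /phi_invariant Mho_sub morphim_Mho //.
  rewrite (MhoEabelian _ (morphim_pgroup phi pK)) //.
  apply/subsetP=> _ /imsetP[a aA ->].
  have: a \in K * <[t]> by rewrite KtG (subsetP sphiG).
  case/mulsgP=> k _ kK /cycleP[j ->] Da.
  (* k and t both lie in the abelian group phi(K). *)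
  have ktC : commute k (t ^+ j).
    have -> : k = a * t ^- j by rewrite Da mulgK.
    apply: (centsP abA); last exact: groupX.
    by rewrite groupM ?groupV ?groupX.
  rewrite Da expgMn // -expgM mulnC expgM expn1 tp1 expg1n mulg1.
  by rewrite -(expn1 p) Mho_p_elt ?(mem_p_elt pK).
apply/abelemP=> //; split=> // x xK; apply/set1gP; rewrite -Mho1.
by rewrite -(expn1 p) Mho_p_elt ?(mem_p_elt pK).
Qed.

End Necessity.

End PrimeIndex.

(** In a suitable basis u_1, ..., u_r of U, psi is the shift
u_1 -> u_2 -> ... -> u_r -> t. The induction peels off the last basis vector x:
write U = V \x <[x]>, take on V the shift that ends in x, and send x to t. In an
element v x^k of an invariant subgroup of U, the component t^k of the image must
be trivial, so invariant subgroups of U already lie in V. *)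
Lemma abelem_shift (p : nat) (gT : finGroupType) (U : {group gT}) (t : gT) :
  prime p -> p.-abelem U -> #[t] = p -> t \in 'C(U) -> t \notin U ->
  exists psi : {morphism U >-> gT},
    psi @* U \subset U <*> <[t]> /\
    forall N : {group gT}, N \subset U -> psi @* N \subset N -> N :=: 1.
Proof.
move=> pr_p; have [n] := ubnP #|U|.
elim: n U t => // n IHn U t ltUn eU ot tC not_tU.
have [U1 | /trivgPn[x xU ntx]] := eqVneq (U : {set gT}) 1.
  exists (triv_morph gT U); split; first by rewrite morphim_trivm sub1G.
  by move=> N; rewrite U1 => /trivgP.
have ox : #[x] = p by apply: abelem_order_p eU xU ntx.
have [V [sVU _ defxV]] := p_abelem_split1 eU xU.
have defU : V \x <[x]> = U by rewrite dprodC.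
have [_ mulVx cVx tiVx] := dprodP defU.
have ltVn : #|V| < n.
  rewrite -ltnS (leq_trans _ ltUn) // ltnS -(dprod_card defU) ltn_Pmulr //.
  by rewrite -/#[x] ox prime_gt1.
have not_xV : x \notin V.
  apply: contra ntx => xV; rewrite -cycle_eq1 -subG1 -tiVx subsetI subxx.
  by rewrite cycle_subG xV.
have xC : x \in 'C(V) by rewrite -cycle_subG.
have [psi [spsi psiP]] := IHn V x ltVn (abelemS sVU eU) ox xC not_xV.
have spsiU : psi @* V \subset U.
  by rewrite (subset_trans spsi) // join_subG sVU cycle_subG.
have dvd_tx : #[t] %| #[x] by rewrite ot ox.
have ctpsi : eltm dvd_tx @* <[x]> \subset 'C(psi @* V).
  by rewrite im_eltm cycle_subG (subsetP (centS spsiU)).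
exists (dprodm_morphism defU ctpsi); split.
  rewrite im_dprodm im_eltm mul_subG ?joing_subr //.
  by rewrite (subset_trans spsiU) ?joing_subl.
move=> N sNU sfN.
have sNV : N \subset V.
  apply/subsetP=> y yN.
  have: y \in V * <[x]> by rewrite mulVx (subsetP sNU).
  case/mulsgP=> v _ vV /cycleP[k ->] Dy.
  have: psi v * t ^+ k \in U.
    rewrite -(eltmE dvd_tx) -(dprodmE defU ctpsi) ?mem_cycle // -Dy.
    by rewrite (subsetP sNU) // (subsetP sfN) // mem_morphim // (subsetP sNU).
  rewrite groupMl; last by rewrite (subsetP spsiU) ?mem_morphim.
  move=> tkU.
  have /set1gP: t ^+ k \in (1 : {set gT}).
    rewrite -(@prime_TIg _ <[t]> U) ?inE ?mem_cycle //.
      by rewrite -/#[t] ot.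
    by rewrite cycle_subG.
  move/eqP; rewrite -order_dvdn ot -ox order_dvdn => /eqP xk1.
  by rewrite Dy xk1 mulg1.
apply: psiP => //; apply: subset_trans sfN.
by rewrite morphim_dprodml.
Qed.

(** The endomorphism is the shift on U = K :&: Z(G), extended trivially to a
complement of U in K. An invariant normal subgroup N meets Z(G) in an
invariant subgroup of U: the image of N :&: Z(G) lies in both U <[t]> and K,
and U <[t]> :&: K = U. *)
Lemma exists_trivial_core (p : nat) (gT : finGroupType) (G K : {group gT})
    (t : gT) :
  prime p -> p.-group G -> K <| G -> p.-abelem K ->
  t \in G :\: K -> #[t] = p ->
  exists phi : {morphism K >-> gT}, phi @* K \subset G /\ trivial_core G phi.
Proof.
move=> pr_p pG nKG eK /setDP[tG not_tK] ot.
pose U := (K :&: 'Z(G))%G.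
have sUK : U \subset K by rewrite subsetIl.
have sUG : U \subset G := subset_trans sUK (normal_sub nKG).
have tC : t \in 'C(U).
  have sUC : U \subset 'C(G) by rewrite /= /center setIA subsetIr.
  by rewrite (subsetP _ t tG) // centsC.
have not_tU : t \notin U by apply: contra not_tK => /(subsetP sUK).
have [psi [spsi psiP]] := abelem_shift pr_p (abelemS sUK eK) ot tC not_tU.
have [M] := splitsP (abelem_splits eK sUK).
case/complP=> tiUM mulUM.
have sMK : M \subset K by rewrite -mulUM mulG_subr.
have defK : U \x M = K.
  by rewrite dprodE // (centSS sMK sUK) //; apply: abelem_abelian eK.
have c1 : triv_morph gT M @* M \subset 'C(psi @* U).
  by rewrite morphim_trivm sub1G.
have sUtG : U <*> <[t]> \subset G by rewrite join_subG sUG cycle_subG.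
exists (dprodm_morphism defK c1); split.
  by rewrite im_dprodm morphim_trivm mulg1 (subset_trans spsi).
apply/trivial_coreP=> N /andP[sNK sfN] nNG.
have NZ1 : N :&: 'Z(G) = 1.
  have sNZU : N :&: 'Z(G) \subset U by rewrite setSI.
  apply: (psiP (N :&: 'Z(G))%G) => //=.
  have sfNZ : psi @* (N :&: 'Z(G)) \subset N.
    rewrite (subset_trans _ sfN) // -(morphim_dprodml defK c1) //.
    by rewrite morphimS ?subsetIl.
  have: psi @* (N :&: 'Z(G)) \subset (U * <[t]>) :&: K.
    rewrite subsetI (subset_trans sfNZ sNK) andbT.
    rewrite -norm_joinEr; first by rewrite (subset_trans (morphimS _ sNZU)).
    by rewrite cycle_subG (subsetP (cent_sub _)).
  have tiK : <[t]> :&: K = 1.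
    by rewrite prime_TIg ?cycle_subG // -/#[t] ot.
  rewrite -group_modl // tiK mulg1.
  by move=> sfU; rewrite subsetI sfNZ (subset_trans sfU) ?subsetIr.
apply/eqP; apply: contraT => ntN.
by rewrite -(negbTE (meet_center_nil (pgroup_nil pG) nNG ntN)) NZ1.
Qed.

(** A section is determined by the image t of a generator of C; conversely an
element t of order p outside the kernel maps to a generator q t of C, and
q t |-> t defines a section. *)
Lemma sequence_splits_prime (p : nat) (gT cT : finGroupType)
    (G : {group gT}) (C : {group cT}) (q : {morphism G >-> cT}) :
  prime p -> #|C| = p -> q @* G = C ->
  sequence_splits C q <-> exists2 t, t \in G :\: 'ker q & #[t] = p.
Proof.
move=> pr_p oC qG; split=> [[s [ssG sK]] | [t /setDP[tG not_tK] ot]].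
  have [c cC ntc] : exists2 c, c \in C & c != 1.
    by apply/trivgPn; rewrite trivg_card1 oC neq_ltn prime_gt1 ?orbT.
  have scG : s c \in G by rewrite (subsetP ssG) ?mem_morphim.
  have qsc : q (s c) = c by apply: sK.
  exists (s c); first by rewrite inE scG andbT (sameP (kerP q scG) eqP) qsc.
  apply: nt_prime_order => //; last first.
    by apply: contraNneq ntc => sc1; rewrite -qsc sc1 morph1.
  by rewrite -morphX // -oC (expg_cardG cC) morph1.
have ntqt : q t != 1 by rewrite -(sameP (kerP q tG) eqP).
have qtC : q t \in C by rewrite -qG mem_morphim.
have oqt : #[q t] = p.
  by apply: nt_prime_order => //; rewrite -oC expg_cardG.
have sC : C \subset <[q t]>.
  have /eqP-> // : C :==: <[q t]>.
  by rewrite eq_sym eqEcard cycle_subG qtC -/#[_] oqt oC /=.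
have dvd_t : #[t] %| #[q t] by rewrite ot oqt.
exists (restrm_morphism sC (eltm_morphism dvd_t)); split.
  rewrite morphim_restrm setIid (subset_trans (morphimS _ sC)) //.
  by rewrite im_eltm cycle_subG.
move=> c cC /=; have /cycleP[k ->] := subsetP sC c cC.
by rewrite /restrm eltmE morphX.
Qed.

Theorem theorem2 (p : nat) (hT gT cT : finGroupType)
    (H : {group hT}) (G : {group gT}) (C : {group cT})
    (i : {morphism H >-> gT}) (q : {morphism G >-> cT}) :
  prime p ->
  cyclic C -> #|C| = p ->
  short_exact C i q ->
  H :!=: 1 -> abelian H -> p.-group H ->
  (exists phi : {morphism (i @* H)%G >-> gT},
     virtual_endomorphism p G phi /\ trivial_core G phi)
  <-> sequence_splits C q /\ p.-abelem H.
Proof.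
move=> pr_p _ oC [inj_i imi qG] ntH abH pH.
have nKG : (i @* H)%G <| G by rewrite /= imi ker_normal.
have iKG : #|G : (i @* H)%G| = p.
  by rewrite /= imi -card_quotient ?ker_norm // (card_isog (first_isog q)) /= qG.
have ntK : (i @* H)%G :!=: 1 by rewrite morphim_injm_eq1.
have abK : abelian (i @* H)%G by rewrite morphim_abelian.
have pK : p.-group (i @* H)%G by rewrite morphim_pgroup.
have splitP := sequence_splits_prime pr_p oC qG; rewrite -imi in splitP.
rewrite -(injm_abelem inj_i) //.
split=> [[phi [[_ _ sphiG] core1]] | [/splitP[t tGK ot] eK]].
  split; last exact: (trivial_core_abelem pr_p nKG iKG sphiG core1 ntK abK pK).
  have [t /setDP[tA not_tK] ot] :=
    trivial_core_order_p pr_p nKG iKG sphiG core1 ntK abK pK.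
  by apply/splitP; exists t; rewrite // inE not_tK (subsetP sphiG).
have pG := prime_index_pgroup pr_p nKG iKG pK.
have [phi [sphiG core1]] := exists_trivial_core pr_p pG nKG eK tGK ot.
by exists phi; split=> //; split=> //; rewrite normal_sub.
Qed.
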